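(* Let $k,t,m\in\mathbb{N}$. For each $j\in\{1,\dots,t\}$ let $X_j$ be a compact Hausdorff space, let $T_{j,1},\dots,T_{j,k}:X_j\to X_j$ be commuting minimal homeomorphisms, let $U_j\subset X_j$ be open and non-empty and, for each $i\in\{1,\dots,k\}$, let $a_i^{(j)}\in\mathbb{Z}[x]$ with $a_i^{(j)}(0)=0$ and let $b_i^{(j)}(n)=\left\lfloor a_i^{(j)}\big(n^{1/m}\big)\right\rfloor$. Then there exists $n\in\mathbb{N}$ such that for each $j\in\{1,\dots,t\}$ we have $$U_j\cap T_{j,1}^{-b_1^{(j)}(n)}U_j\cap\cdots\cap T_{j,k}^{-b_k^{(j)}(n)}U_j\neq\varnothing.$$
   Context: $\mathbb{N}=\{1,2,\dots\}$. A homeomorphism $T:X\to X$ of a compact Hausdorff space is minimal if there is no non-empty proper compact subset $Y\subset X$ with $T^{-1}Y\subset Y$. *)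

(* Defs.v *)
From HB Require Import structures.
From mathcomp Require Import all_boot all_order all_algebra.
From mathcomp Require Import all_classical all_reals all_analysis.

Set Implicit Arguments.
Unset Strict Implicit.
Unset Printing Implicit Defensive.

Import Order.TTheory GRing.Theory Num.Theory.

Local Open Scope classical_set_scope.
Local Open Scope ring_scope.

Record homeomorphism (X : topologicalType) := Homeomorphism {
  homeo_fun :> X -> X;
  homeo_inv : X -> X;
  homeo_funK : cancel homeo_fun homeo_inv;
  homeo_invK : cancel homeo_inv homeo_fun;
  homeo_fun_continuous : continuous homeo_fun;
  homeo_inv_continuous : continuous homeo_inv
}.

Definition minimal (X : topologicalType) (T : homeomorphism X) : Prop :=
  ~ exists Y : set X,
      [/\ Y !=set0, Y `<` setT, compact Y & T @^-1` Y `<=` Y].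

(* [Negz p] denotes - (p.+1). *)
Definition homeo_iter (X : topologicalType) (T : homeomorphism X) (b : int)
  : X -> X :=
  match b with
  | Posz p => iter p T
  | Negz p => iter p.+1 (homeo_inv T)
  end.

Definition floor_poly_root (R : realType) (m : nat) (a : {poly int}) (n : nat)
  : int :=
  Num.floor (map_poly (intr : int -> R) a).[n%:R `^ (m%:R^-1)].

(* Main.v *)
Require Import Defs.
From HB Require Import structures.
From mathcomp Require Import all_boot all_order all_algebra.
From mathcomp Require Import ring.
From mathcomp Require Import all_classical all_reals all_analysis.

Set Implicit Arguments.
Unset Strict Implicit.
Unset Printing Implicit Defensive.

Import Order.TTheory GRing.Theory Num.Theory.

Local Open Scope classical_set_scope.
Local Open Scope ring_scope.

(** Along the powers [n = N ^ m] the integer part disappears: [n ^ (1/m) = N], so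
the exponents are the integer polynomials [a j i] evaluated at [N]
([floor_poly_root_exp]).  What is left is polynomial multiple recurrence,
simultaneously in finitely many systems, and this follows from the polynomial
van der Waerden theorem of Bergelson and Leibman
([polynomial_van_der_Waerden]): every finite colouring of the additive group
of an integral domain [R] gives one colour to [b] and to all [b + p.[n]], for some
[b] and some [n > 0], where [p] ranges over a prescribed finite set of
polynomials over [R] vanishing at 0.

To transfer recurrence into a colouring, note that by minimality and
compactness there is a bound on the time that any point of [X j] needs to reach
[U j] under the inverse of one fixed transformation [T j i0]
([minimal_bounded_return]).  Fix a point [x0 j] in every [X j], let a vector of
exponents act on [x0 j] by the commuting transformations [T j i], and colour
the vector by the tuple, over [j], of the times that the resulting points need
to reach [U j].  Let [P i] be the vector polynomial with entry [a j i] at the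
place of [T j i], for every [j], and 0 elsewhere.  If [b] and all [b + P i (N)]
have the same colour [s], then applying [T j i0] to the power [- s j] to the
point of [b] gives a point of [U j] which each [T j i] to the power
[(a j i).[N]] sends back into [U j], because all these transformations commute.
One colouring treats all [j] at once, hence the common [N].

The van der Waerden theorem is proved by the colour focusing argument of
Walters.  For a fixed [p1] in the family [A], one looks for an increasing number
of monochromatic sets [a + p.[d]], [p] in [A], of pairwise distinct colours, all of
them seen from the same focus [a]; when the colours are exhausted, [a] has the
colour of one of these sets.  One more set is gained by applying the theorem
to the polynomials [p (X + h) - p (h) - p1 (X)]
([monochromatic_family_focus]).  If [p1] is of least degree in [A], this new
family is simpler in the sense of PET induction: it has fewer leading
coefficients in the degree of [p1] and no new ones in larger degrees
([lead_increment], [weight_ind]). *)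

(** * Induction on weights *)

(** Weights are compared at the largest index where they differ, which is a well
founded order on finitely supported weights; [<=] above an index where the
weight drops is enough to be smaller.  In the proof, drops are allowed only
from index [D] on; induction on [D] brings this down to the hypothesis of the
step, each [D] being handled by induction on the value [w A D]. *)
Lemma weight_ind (I : Type) (w : I -> nat -> nat) (P : I -> Prop) :
  (forall A, exists D, forall s, (D <= s)%N -> w A s = 0%N) ->
  (forall A, (forall B s, (w B s < w A s)%N ->
      (forall u, (s < u)%N -> (w B u <= w A u)%N) -> P B) -> P A) ->
  forall A, P A.
Proof.
move=> wfin step A.
have main D : forall A, (forall B s, (D <= s)%N -> (w B s < w A s)%N ->
    (forall u, (s < u)%N -> (w B u <= w A u)%N) -> P B) -> P A.
  elim: D => [|D IHD] {}A hA.
    by apply: step => B s; apply: hA.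
  have [N leN] := ubnP (w A D); elim: N => // N IHN in A hA leN *.
  apply: IHD => B s; rewrite leq_eqVlt => /predU1P[<-{s}|] ltDs; last first.
    exact: hA.
  move=> leBA; apply: IHN; last by apply: leq_trans ltDs _; rewrite -ltnS.
  move=> E s ltDs' ltEB leEB; apply: (hA _ s) => //.
    exact: leq_trans ltEB (leBA _ _).
  move=> u ltsu; apply: leq_trans (leEB _ ltsu) (leBA _ _).
  exact: ltn_trans ltDs' ltsu.
have [D wA0] := wfin A.
by apply: (main D) => B s /wA0 ->; rewrite ltn0.
Qed.

(** * The polynomial van der Waerden theorem *)

Section PolynomialVanDerWaerden.

Variable R : idomainType.
Implicit Types (A B : seq {poly R}) (p q : {poly R}) (C : finType).

(** The solutions [(b, n)] range over a finite list chosen before the colouring.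
This compactness is built into the definition because the induction recolours
[x] by the colours of a whole finite window around [x], and that window must
not depend on the colouring. *)
Definition monochromatic_family A : Prop := forall C, exists F : seq (R * nat),
  forall chi : R -> C, exists b n, [/\ (b, n) \in F, (0 < n)%N &
    {in A, forall p, chi (b + p.[n%:R]) = chi b}].

Definition increment p1 p (h : nat) : {poly R} :=
  p \Po ('X + h%:R%:P) - p.[h%:R]%:P - p1.

Lemma horner_increment p1 p h x :
  (increment p1 p h).[x] = p.[x + h%:R] - p.[h%:R] - p1.[x].
Proof. by rewrite !hornerE horner_comp !hornerE. Qed.

Definition increments A p1 (H : seq nat) : seq {poly R} :=
  [seq increment p1 p h | p <- A, h <- H].

(** Colour focusing.  Suppose that [r] sets [a + p.[d]] of distinct colours are focused
at [a], and that everything near [a] looks the same when translated by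
[q.[n]], for [q] the increments of [A].  Since
[p.[n + d] - p1.[n] = p.[d] + (increment p1 p d).[n]], moving the focus to
[a - p1.[n]] and the parameters [d] to [n + d] preserves the [r] sets and
their colours, while the parameter [n] itself, which corresponds to [d = 0],
gives a further set with the colour of the old focus [a]. *)
Lemma monochromatic_family_focus A p1 :
  p1 \in A -> {in A, forall p, p.[0] = 0} ->
  (forall H, monochromatic_family (increments A p1 H)) ->
  monochromatic_family A.
Proof.
move=> p1A A0 incA C.
(* The alternative at the end records that the focus may have been absorbed by
   one of the sets, in which case nothing has to be gained. *)
have focus r : exists F : seq (R * seq nat), forall chi : R -> C, exists a ds,
    let colours := [seq chi (a + p1.[d%:R]) | d : nat <- ds] in
    [/\ (a, ds) \in F, all (leq 1) ds, uniq colours,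
      forall p d, p \in A -> d \in ds ->
        chi (a + p.[d%:R]) = chi (a + p1.[d%:R]) &
      (chi a \in colours) || (r <= size ds)%N].
  elim: r => [|r [F hF]].
    exists [:: (0, [::])] => chi; exists 0, [::] => /=.
    by split=> //; rewrite ?inE ?eqxx.
  pose H := 0%N :: flatten [seq x.2 | x <- F].
  (* The window contains every point the old configurations may involve;
     [0] in [H] accounts for the new set. *)
  pose W := [seq u + v | u <- [seq x.1 | x <- F],
                         v <- [seq p.[h%:R] | p <- A, h <- H]].
  have [G hG] := incA H ((size W).-tuple C : finType).
  pose shift x := [:: (x.1.1 + x.2.1, x.2.2);
    (x.1.1 + x.2.1 - p1.[x.1.2%:R], x.1.2 :: map (addn x.1.2) x.2.2)].
  exists (flatten [seq shift (x, y) | x <- G, y <- F]) => chi.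
  have [b [n [Gbn n_gt0 chiW]]] :=
    hG (fun x => map_tuple (fun w => chi (x + w)) (in_tuple W)).
  have {}chiW p h u : p \in A -> h \in H -> u \in [seq x.1 | x <- F] ->
      chi (b + u - p1.[n%:R] + p.[n%:R + h%:R]) = chi (b + (u + p.[h%:R])).
    move=> pA hH uF.
    have /chiW/(congr1 val)/= : increment p1 p h \in increments A p1 H.
      exact: allpairs_f.
    move/eq_in_map => /(_ (u + p.[h%:R])).
    rewrite horner_increment => <-; last first.
      by apply: allpairs_f => //; apply: allpairs_f.
    by congr chi; ring.
  have [a [ds [Fads ds_gt0 Uds monods focusds]]] := hF (fun x => chi (b + x)).
  have aF : a \in [seq x.1 | x <- F] by apply: (map_f (@fst _ _) Fads).
  have dsH d : d \in ds -> d \in H.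
    move=> dds; rewrite in_cons; apply/orP; right; apply/flattenP.
    by exists ds => //; apply: (map_f (@snd _ _) Fads).
  set cols := map _ ds in Uds focusds.
  (* The new focus is the old one if the latter is absorbed. *)
  have [a_cols | aNcols] := boolP (chi (b + a) \in cols).
    exists (b + a), ds; split => //.
    - apply/flattenP; exists (shift ((b, n), (a, ds))); first exact: allpairs_f.
      exact: mem_head.
    - by move: Uds; congr uniq; apply: eq_map => d; rewrite addrA.
    - by move=> p d pA dds; rewrite -!addrA; apply: monods.
    - apply/orP; left; move: a_cols; congr (_ \in _).
      by apply: eq_map => d; rewrite addrA.
  rewrite (negPf aNcols) /= in focusds.
  have chi0 p : p \in A -> chi (b + a - p1.[n%:R] + p.[n%:R]) = chi (b + a).
    move=> pA; have := chiW p 0%N a pA (mem_head _ _) aF.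
    by rewrite addr0 (A0 p) ?addr0.
  have chid p d : p \in A -> d \in ds ->
      chi (b + a - p1.[n%:R] + p.[(n + d)%:R]) = chi (b + (a + p1.[d%:R])).
    move=> pA dds; rewrite natrD chiW ?dsH //; exact: monods.
  exists (b + a - p1.[n%:R]), (n :: map (addn n) ds).
  have Ecols : [seq chi (b + a - p1.[n%:R] + p1.[d%:R])
      | d : nat <- n :: map (addn n) ds] = chi (b + a) :: cols.
    rewrite /= chi0 //; congr cons; rewrite -map_comp.
    apply/eq_in_map => d dds /=; exact: chid.
  rewrite Ecols; split => //.
  - apply/flattenP; exists (shift ((b, n), (a, ds))); first exact: allpairs_f.
    by rewrite !inE eqxx orbT.
  - rewrite /= n_gt0 all_map; apply: sub_all ds_gt0 => d /= d_gt0.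
    by rewrite addn_gt0 n_gt0.
  - by rewrite /= aNcols Uds.
  - move=> p d pA; rewrite inE => /predU1P[->|/mapP[e eds ->]].
      by rewrite !chi0.
    by rewrite !chid.
  - by rewrite /= size_map ltnS focusds orbT.
have [F hF] := focus #|C|.+1.
exists [seq (x.1, d) | x <- F, d <- x.2] => chi.
have [a [ds [Fads /allP ds_gt0 Uds monods]]] := hF chi.
case/orP => [/mapP[d dds chia]|]; last first.
  have := card_uniqP Uds; rewrite size_map => <-.
  by rewrite ltnNge max_card.
exists a, d; split; last by move=> p pA; rewrite monods.
  by apply/allpairsPdep; exists (a, ds), d.
exact: ds_gt0.
Qed.

Lemma monochromatic_family_nonzero A :
  monochromatic_family [seq p <- A | p != 0] -> monochromatic_family A.
Proof.
move=> famA C; have [F hF] := famA C; exists F => chi.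
have [b [n [Fbn n_gt0 chib]]] := hF chi; exists b, n; split => // p pA.
have [->|p_neq0] := eqVneq p 0; first by rewrite horner0 addr0.
by rewrite chib // mem_filter p_neq0.
Qed.

(** The zero polynomial is discarded: it imposes no condition on a colouring, but
its increment [- p1] would bring a new leading coefficient in the degree of
[p1]. *)
Definition leads A s : seq R :=
  undup [seq lead_coef p | p <- [seq p <- A | p != 0] & size p == s].

Lemma mem_leads A s l : reflect
  (exists p, [/\ p \in A, p != 0, size p = s & l = lead_coef p])
  (l \in leads A s).
Proof.
rewrite mem_undup; apply: (iffP mapP) => [[p]|[p [pA p0 sp ->]]].
  by rewrite !mem_filter => /and3P[/eqP sp p0 pA] ->; exists p.
by exists p; rewrite // !mem_filter sp eqxx p0.
Qed.

Lemma size_shift p h : size (p \Po ('X + h%:R%:P)) = size p.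
Proof. by rewrite size_comp_poly2 // size_XaddC. Qed.

Lemma lead_coef_shift p h : lead_coef (p \Po ('X + h%:R%:P)) = lead_coef p.
Proof.
by rewrite lead_coef_comp ?size_XaddC // lead_coefXaddC expr1n mulr1.
Qed.

Lemma size_gt1_root0 p : p != 0 -> p.[0] = 0 -> (1 < size p)%N.
Proof. by move=> p0 /eqP; apply: root_size_gt1. Qed.

(** Up to terms of smaller degree the increment is [p - p1], since translating the
variable does not change the leading term and [p] is not constant. *)
Lemma lead_increment p1 p h : p != 0 -> p.[0] = 0 ->
  (size p1 <= size p)%N -> increment p1 p h != 0 ->
  (size (increment p1 p h) <= size p)%N /\
  ((size p1 <= size (increment p1 p h))%N ->
   size (increment p1 p h) = size p /\
   lead_coef (increment p1 p h) =
     if size p1 == size p then lead_coef p - lead_coef p1 else lead_coef p).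
Proof.
move=> p0 p00 lep1p.
set q := p \Po ('X + h%:R%:P) - p.[h%:R]%:P.
have ltC : (size (- p.[h%:R]%:P)%R < size (p \Po ('X + h%:R%:P)))%N.
  rewrite size_polyN size_shift.
  exact: leq_ltn_trans (size_polyC_leq1 _) (size_gt1_root0 p0 p00).
have sq : size q = size p by rewrite size_polyDl // size_shift.
have lq : lead_coef q = lead_coef p by rewrite lead_coefDl // lead_coef_shift.
rewrite /increment -/q => d0.
have led : (size (q - p1)%R <= size p)%N.
  by rewrite (leq_trans (size_polyD _ _)) // size_polyN sq geq_max leqnn.
split=> //; case: eqP => [e|/eqP ne]; last first.
  have lt : (size (- p1)%R < size q)%N by rewrite size_polyN sq ltn_neqAle ne.
  by rewrite size_polyDl // lead_coefDl // sq lq.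
rewrite e => ge; have sd : size (q - p1) = size p.
  by apply/eqP; rewrite eqn_leq led.
split=> //.
by rewrite [LHS]lead_coefE sd coefB -lq !lead_coefE sq e.
Qed.

(** PET induction: the weight of a family counts its leading coefficients in each
degree.  With [p1] of least degree, the leading coefficients of the increments
are unchanged above the degree of [p1], and in that degree they are the
[l - l1] with [l <> l1], [l1] being that of [p1]: at least one is lost. *)
Theorem polynomial_van_der_Waerden A :
  {in A, forall p, p.[0] = 0} -> monochromatic_family A.
Proof.
move: A; apply: (weight_ind (w := fun A s => size (leads A s))).
  move=> A; exists (\max_(p <- A) size p).+1 => s.
  apply: contraTeq; rewrite size_eq0 -leqNgt => leadsN0.
  case E : (leads A s) leadsN0 => [//|l ls] _.
  have /mem_leads[p [pA _ <- _]] : l \in leads A s by rewrite E mem_head.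
  exact: leq_bigmax_seq.
move=> A IH A0; apply: monochromatic_family_nonzero.
set A' := [seq p <- A | p != 0].
have A'P p : p \in A' -> [/\ p \in A, p != 0 & p.[0] = 0].
  by rewrite mem_filter => /andP[p0 pA]; split => //; apply: A0.
have [A'0 | A'N0] := boolP (nilp A').
  rewrite (nilP A'0) => C; exists [:: (0, 1%N)] => chi.
  by exists 0, 1%N; rewrite mem_head.
have exA' : exists s, has (fun p => size p == s) A'.
  case E : A' A'N0 => [//|p ps] _; exists (size p).
  by apply/hasP; exists p; rewrite ?mem_head.
case: (ex_minnP exA') => s /hasP[p1 p1A' /eqP <-{s}] min_p1.
have {}min_p1 p : p \in A' -> (size p1 <= size p)%N.
  by move=> pA'; apply: min_p1; apply/hasP; exists p.
apply: (monochromatic_family_focus p1A') => [p /A'P[]//|H].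
have [p1A p1_neq0 _] := A'P _ p1A'.
apply: (IH _ (size p1)) => [|s lt_s|_ /allpairsP[[p h] /= [pA' _ ->]]].
- (* The increments of polynomials with the leading term of [p1] have lower
     degree. *)
  pose L := [seq l - lead_coef p1 | l <- leads A (size p1) & l != lead_coef p1].
  have leL : (size L < size (leads A (size p1)))%N.
    rewrite size_map size_filter.
    rewrite -(count_predC (pred1 (lead_coef p1)) (leads _ _)).
    rewrite -[X in (X < _)%N]add0n ltn_add2r -has_count has_pred1.
    by apply/mem_leads; exists p1.
  apply: leq_ltn_trans leL; apply: uniq_leq_size; first exact: undup_uniq.
  move=> _ /mem_leads[_ [/allpairsP[[p h] /= [pA' _ ->]] d0 sd ->]].
  have [pA p0 p00] := A'P _ pA'.
  have [_] := lead_increment p0 p00 (min_p1 _ pA') d0.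
  rewrite sd leqnn => /(_ isT)[sp]; rewrite sp eqxx => ld.
  rewrite ld; apply: map_f; rewrite mem_filter -subr_eq0 -ld lead_coef_eq0 d0.
  by apply/mem_leads; exists p.
- apply: uniq_leq_size; first exact: undup_uniq.
  move=> _ /mem_leads[_ [/allpairsP[[p h] /= [pA' _ ->]] d0 sd ->]].
  have [pA p0 p00] := A'P _ pA'.
  have [_] := lead_increment p0 p00 (min_p1 _ pA') d0.
  rewrite sd (ltnW lt_s) => /(_ isT)[sp]; rewrite -sp (ltn_eqF lt_s) => ->.
  by apply/mem_leads; exists p.
- by have [_ _ p00] := A'P _ pA'; rewrite horner_increment add0r subrr
    (A0 _ p1A) subr0.
Qed.

End PolynomialVanDerWaerden.

(** * Iterates of homeomorphisms *)

Section HomeomorphismIterates.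

Variables (X : topologicalType) (T : homeomorphism X).

Lemma homeo_iterD (b c : int) x :
  homeo_iter T (b + c) x = homeo_iter T b (homeo_iter T c x).
Proof.
have succ d y : homeo_iter T (1 + d) y = T (homeo_iter T d y).
  by case: d => [p|[|p]] /=; rewrite ?homeo_invK ?subn1.
elim/int_ind: b => [|p IH|p IH]; first by rewrite add0r.
  by rewrite -[p.+1]add1n PoszD -addrA !succ IH.
apply: (can_inj (homeo_funK T)).
by rewrite -!succ !addrA -[p.+1]add1n PoszD opprD addrA subrr sub0r IH.
Qed.

Lemma homeo_iter_comm (f : X -> X) (b : int) x :
  (forall y, f (T y) = T (f y)) ->
  f (homeo_iter T b x) = homeo_iter T b (f x).
Proof.
move=> fT; case: b => p /=; first by elim: p => //= p <-; rewrite fT.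
have fTi y : f (homeo_inv T y) = homeo_inv T (f y).
  by apply: (can_inj (homeo_funK T)); rewrite -fT !homeo_invK.
by rewrite fTi; congr homeo_inv; elim: p => //= p <-; rewrite fTi.
Qed.

Lemma continuous_iter_inv s : continuous (iter s (homeo_inv T)).
Proof.
elim: s => [|s IH] x; first exact: cvg_id.
by apply: continuous_comp; [exact: IH | exact: homeo_inv_continuous].
Qed.

(** The points whose backward orbit avoids [U] form a closed set [Y], not the whole
space, such that [T x] in [Y] implies [x] in [Y]; by minimality it is empty, and
compactness makes the return time bounded.  Backward orbits are the ones to
use, since minimality is about the sets with [T^-1 Y] contained in [Y]. *)
Lemma minimal_bounded_return (U : set X) :
  compact [set: X] -> minimal T -> open U -> U !=set0 ->
  exists S : nat, forall x, exists s : 'I_S.+1, U (iter s (homeo_inv T) x).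
Proof.
move=> cptX minT openU [u Uu].
have hit x : exists s, U (iter s (homeo_inv T) x).
  apply: contrapT => noreturn; apply: minT.
  exists (\bigcap_s (iter s (homeo_inv T) @^-1` ~` U)); split.
  - by exists x => s _ Us; apply: noreturn; exists s.
  - by split=> // /(_ u I) /(_ 0%N I).
  - apply: (subclosed_compact _ cptX) => //; apply: closed_bigI => s _.
    apply: preimage_closed => [y _|]; first exact: continuous_iter_inv.
    exact: open_closedC.
  - move=> y Ty s _ /=; have := Ty s.+1 I.
    by rewrite /= -iterS iterSr homeo_funK.
have /compact_near_coveringP cov := cptX.
have [x _|S _ hS] := cov nat \oo
    (fun N x => exists2 s, (s <= N)%N & U (iter s (homeo_inv T) x)) _.
  have [s Us] := hit x.
  exists (iter s (homeo_inv T) @^-1` U, [set N | (s <= N)%N]) => /=.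
    split; last exact: nbhs_infty_ge.
    by apply: continuous_iter_inv; apply: open_nbhs_nbhs; split.
  by move=> [y N] /= [Uy sN]; exists s.
exists S => x; have [s sS Us] := hS S (leqnn _) x I.
by exists (inord s); rewrite inordK.
Qed.

End HomeomorphismIterates.

Definition joint_iter (X : topologicalType) (I : Type) (T : I -> homeomorphism X)
  (r : seq I) (v : I -> int) (x : X) : X :=
  foldr (fun i => homeo_iter (T i) (v i)) x r.

(** Commutation lets the extra power [c] of [T i] move out past the powers of the
other transformations that come before [i] in [r]. *)
Lemma joint_iter_shift (X : topologicalType) (I : eqType)
    (T : I -> homeomorphism X) (r : seq I) (v w : I -> int) i c x :
  (forall i i' x, T i (T i' x) = T i' (T i x)) ->
  uniq r -> i \in r -> (forall i', w i' = if i' == i then c + v i' else v i') ->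
  joint_iter T r w x = homeo_iter (T i) c (joint_iter T r v x).
Proof.
move=> Tcomm + + wE.
have ext s : i \notin s -> joint_iter T s w x = joint_iter T s v x.
  elim: s => //= i' s IH; rewrite inE negb_or eq_sym => /andP[ne /IH ->].
  by rewrite wE (negPf ne).
elim: r => //= i' r IH /andP[i'r Ur]; rewrite inE wE eq_sym.
case: eqP => [e _|_ /= ir].
  by rewrite e homeo_iterD ext // -e.
rewrite IH //; apply/esym/homeo_iter_comm => y.
by apply/esym/homeo_iter_comm => z.
Qed.

(** * Multiple recurrence *)

Lemma floor_poly_root_exp (R : realType) (m : nat) (a : {poly int}) (n : nat) :
  (0 < m)%N -> floor_poly_root R m a (n ^ m) = a.[n%:R].
Proof.
move=> m_gt0; rewrite /floor_poly_root natrX -powR_mulrn // -powRrM.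
rewrite divff ?pnatr_eq0 -?lt0n // powRr1 //.
by rewrite -[n%:R](rmorph_nat (intr : int -> R)) horner_map /= intrKfloor.
Qed.

Theorem corollary8p12 (R : realType) (k t m : nat)
  (k_gt0 : (0 < k)%N) (t_gt0 : (0 < t)%N) (m_gt0 : (0 < m)%N)
  (X : 'I_t -> topologicalType)
  (X_compact : forall j, compact [set: X j])
  (X_hausdorff : forall j, hausdorff_space (X j))
  (T : forall j, 'I_k -> homeomorphism (X j))
  (T_commute : forall j (i i' : 'I_k) (x : X j),
     T j i (T j i' x) = T j i' (T j i x))
  (T_minimal : forall j i, minimal (T j i))
  (U : forall j, set (X j))
  (U_open : forall j, open (U j))
  (U_neq0 : forall j, U j !=set0)
  (a : 'I_t -> 'I_k -> {poly int})
  (a_at0 : forall j i, (a j i).[0] = 0) :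
  exists n : nat, (0 < n)%N /\
    forall j : 'I_t,
      U j `&` \bigcap_(i in [set: 'I_k])
        (homeo_iter (T j i) (floor_poly_root R m (a j i) n) @^-1` U j)
      !=set0.
Proof.
pose i0 := Ordinal k_gt0.
have [S hS] := choice (fun j => minimal_bounded_return (@X_compact j)
  (T_minimal j i0) (U_open j) (U_neq0 j)).
pose D := \max_j S j.
have return_to j (x : X j) :
    exists s : 'I_D.+1, U j (iter s (homeo_inv (T j i0)) x).
  have [s Us] := hS j x; exists (inord s); rewrite inordK //.
  by apply: leq_trans (ltn_ord s) _; rewrite ltnS; apply: leq_bigmax.
pose time j x := projT1 (cid (return_to j x)).
have Utime j x : U j (iter (time j x) (homeo_inv (T j i0)) x).
  exact: (projT2 (cid (return_to j x))).
pose x0 j := projT1 (cid (U_neq0 j)).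
(* The additive group of [{poly int}] serves as the group of exponent vectors:
   the coefficient of index [e j i] is the exponent of [T j i]. *)
pose e j i := pickle (j : 'I_t, i : 'I_k).
pose orbit j (v : {poly int}) :=
  joint_iter (T j) (enum 'I_k) (fun i => v`_(e j i)) (x0 j).
pose P i : {poly {poly int}} :=
  \sum_j 'X^(e j i) *: map_poly (@polyC int) (a j i).
have PE i n : (P i).[n%:R] = \sum_j (a j i).[n%:R] *: 'X^(e j i).
  rewrite horner_sum; apply: eq_bigr => j _; rewrite hornerZ.
  by rewrite -[n%:R](rmorph_nat (@polyC int)) horner_map /= mulrC mul_polyC.
have coefP j i i' n :
    ((P i).[n%:R])`_(e j i') = if i' == i then (a j i).[n%:R] else 0.
  rewrite PE coef_sum (bigD1 j) //= big1 ?addr0 => [|j' ne].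
    rewrite coefZ coefXn (inj_eq (pcan_inj pickleK)) xpair_eqE eqxx /=.
    by case: eqP; rewrite ?mulr1 ?mulr0.
  rewrite coefZ coefXn (inj_eq (pcan_inj pickleK)) xpair_eqE eq_sym (negPf ne).
  by rewrite mulr0.
have P0 : {in [seq P i | i <- enum 'I_k], forall p, p.[0] = 0}.
  move=> _ /mapP[i _ ->]; rewrite (PE i 0%N) big1 // => j _.
  by rewrite a_at0 scale0r.
have [F hF] := polynomial_van_der_Waerden P0 ({ffun 'I_t -> 'I_D.+1} : finType).
have [b [N [_ N_gt0 chib]]] := hF (fun v => [ffun j => time j (orbit j v)]).
exists (N ^ m)%N; split=> [|j]; first by rewrite expn_gt0 N_gt0.
exists (iter (time j (orbit j b)) (homeo_inv (T j i0)) (orbit j b)).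
split=> [|i _ /=]; first exact: Utime.
rewrite floor_poly_root_exp //.
have Ti y : homeo_inv (T j i0) (homeo_iter (T j i) (a j i).[N%:R] y) =
    homeo_iter (T j i) (a j i).[N%:R] (homeo_inv (T j i0) y).
  apply: homeo_iter_comm => z; apply: (can_inj (homeo_funK (T j i0))).
  by rewrite T_commute !homeo_invK.
have -> y s :
    homeo_iter (T j i) (a j i).[N%:R] (iter s (homeo_inv (T j i0)) y) =
    iter s (homeo_inv (T j i0)) (homeo_iter (T j i) (a j i).[N%:R] y).
  by elim: s => //= s <-; rewrite Ti.
have <- : orbit j (b + (P i).[N%:R]) =
    homeo_iter (T j i) (a j i).[N%:R] (orbit j b).
  apply: joint_iter_shift; rewrite ?enum_uniq ?mem_enum // => i'.
  by rewrite coefD coefP; case: eqP; rewrite ?addr0 // addrC.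
have /ffunP/(_ j) := chib (P i) (map_f _ (mem_enum _ i)).
by rewrite !ffunE => <-; apply: Utime.
Qed.
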